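(* Let $m\ge1$, $k\ge1$ and $h\le k-1$ be integers. The generating function for the number of partitions $\lambda$ of $n$ into odd parts with an $h$-fixed hook in the $m$th column that arises from a hook of size $k$ (i.e. the row $s=k-h$ satisfies $\lambda_s\ge m$ and $h_{s,m}(\lambda)=k$) is \[ \sum_{\substack{l=1\\ l\ \mathrm{odd}}}^{k}\frac{q^{k+l(k-h-1)+(m-1)(2k-h-l)}}{(q^2;q^2)_{k-h-1}(q;q^2)_{(m-1)/2}}\binom{k-l+(l-1)/2}{k-l}_{q^2} \] if $m$ is odd, and \[ \sum_{\substack{l=1\\ l\ \mathrm{even}}}^{k}\frac{q^{k+l(k-h-1)+(m-1)(2k-h-l)+(k-l)}}{(q^2;q^2)_{k-h-1}(q;q^2)_{m/2}}\binom{k-l+(l-2)/2}{k-l}_{q^2} \] if $m$ is even.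
   Context: For a partition $\lambda$ with conjugate $\lambda'$, $h_{i,j}(\lambda)=\lambda_i+\lambda'_j-i-j+1$ is the hook length of cell $(i,j)$, $j\le\lambda_i$. An $h$-fixed hook in the $m$th column is a row $i$ with $\lambda_i\ge m$ and $h_{i,m}(\lambda)=i+h$. Notation: $(a;b)_n=\prod_{t=0}^{n-1}(1-ab^t)$, and $\binom{a}{b}_{q^2}$ is the Gaussian binomial coefficient $\frac{(q;q)_a}{(q;q)_b(q;q)_{a-b}}$ with $q$ replaced by $q^2$. *)

(* Defs.v *)
From HB Require Import structures.
From mathcomp Require Import all_boot all_order all_algebra.
From mathcomp Require Import boolp.
Set Implicit Arguments.
Unset Strict Implicit.
Unset Printing Implicit Defensive.
Import GRing.Theory.
Local Open Scope ring_scope.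

(* Formal power series R[[q]]. A series is a unit iff its constant            *)
(* coefficient is one, so [/] is honest division whenever the denominator     *)
(* has constant coefficient 1 (and, as usual in MathComp, [x^-1 = x] on       *)
(* non-units).                                                                *)
Record fps (R : Type) := Fps { fpcoef : nat -> R }.
Arguments fpcoef {R} f n : rename.

Lemma fpsP (R : Type) (f g : fps R) : fpcoef f =1 fpcoef g <-> f = g.
Proof.
split=> [eq_fg|->//].
by case: f g eq_fg => f [g] /= /funext ->.
Qed.

HB.instance Definition _ (R : Type) := gen_eqMixin (fps R).
HB.instance Definition _ (R : Type) := gen_choiceMixin (fps R).

Section FpsZmodule.
Variable R : zmodType.
Implicit Types f g h : fps R.

Definition fps_zero : fps R := Fps (fun=> 0).
Definition fps_opp f := Fps (fun n => - fpcoef f n).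
Definition fps_add f g := Fps (fun n => fpcoef f n + fpcoef g n).

Fact fps_addA : associative fps_add.
Proof. by move=> f g h; apply/fpsP => n /=; rewrite addrA. Qed.
Fact fps_addC : commutative fps_add.
Proof. by move=> f g; apply/fpsP => n /=; rewrite addrC. Qed.
Fact fps_add0 : left_id fps_zero fps_add.
Proof. by move=> f; apply/fpsP => n /=; rewrite add0r. Qed.
Fact fps_addN : left_inverse fps_zero fps_opp fps_add.
Proof. by move=> f; apply/fpsP => n /=; rewrite addNr. Qed.

HB.instance Definition _ :=
  GRing.isZmodule.Build (fps R) fps_addA fps_addC fps_add0 fps_addN.
End FpsZmodule.

Section FpsRing.
Variable R : comNzRingType.
Implicit Types f g h : fps R.

Definition fps_one : fps R := Fps (fun n => (n == 0%N)%:R).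
Definition fpsX : fps R := Fps (fun n => (n == 1%N)%:R).
Definition fps_mul f g :=
  Fps (fun n => \sum_(i < n.+1) fpcoef f i * fpcoef g (n - i)%N).

Let trunc N f : {poly R} := \poly_(i < N) fpcoef f i.

Let fps_mul_trunc N f g n : (n < N)%N ->
  fpcoef (fps_mul f g) n = (trunc N f * trunc N g)`_n.
Proof.
move=> lt_nN; rewrite coefM /=; apply: eq_bigr => i _.
rewrite !coef_poly (leq_ltn_trans (leq_subr _ _) lt_nN).
by rewrite (leq_trans (ltn_ord i)).
Qed.

Let trunc_mul N f g n : (n < N)%N ->
  (trunc N (fps_mul f g))`_n = (trunc N f * trunc N g)`_n.
Proof. by move=> lt_nN; rewrite coef_poly lt_nN -fps_mul_trunc. Qed.

Fact fps_mulA : associative fps_mul.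
Proof.
move=> f g h; apply/fpsP => n.
rewrite !(@fps_mul_trunc n.+1) //.
transitivity ((trunc n.+1 f * (trunc n.+1 g * trunc n.+1 h))`_n).
  rewrite !coefM; apply: eq_bigr => i _; congr (_ * _).
  by rewrite trunc_mul // ltnS leq_subr.
rewrite mulrA !coefM; apply: eq_bigr => i _; congr (_ * _).
by rewrite -trunc_mul.
Qed.
Fact fps_mulC : commutative fps_mul.
Proof. by move=> f g; apply/fpsP => n; rewrite !(@fps_mul_trunc n.+1) // mulrC. Qed.
Fact fps_mul1 : left_id fps_one fps_mul.
Proof.
move=> f; apply/fpsP => n /=.
rewrite big_ord_recl /= subn0 mul1r big1 ?addr0 // => i _.
by rewrite mul0r.
Qed.
Fact fps_mulDl : left_distributive fps_mul +%R.
Proof.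
move=> f g h; apply/fpsP => n /=; rewrite -big_split.
by apply: eq_bigr => i _ /=; rewrite mulrDl.
Qed.
Fact fps_one_neq0 : fps_one != 0.
Proof. by apply/eqP => /fpsP/(_ 0%N)/eqP; rewrite /= oner_eq0. Qed.

HB.instance Definition _ := GRing.Zmodule_isComNzRing.Build (fps R)
  fps_mulA fps_mulC fps_mul1 fps_mulDl fps_one_neq0.

Lemma fpcoefM f g n :
  fpcoef (f * g) n = \sum_(i < n.+1) fpcoef f i * fpcoef g (n - i)%N.
Proof. by []. Qed.
End FpsRing.

Section FpsUnitRing.
Variable R : comUnitRingType.
Implicit Types f g : fps R.

(* The first n coefficients b_0, ..., b_(n-1) of 1 / f, from the recurrence   *)
(* f_0 b_n = [n = 0] - \sum_(i < n) f_(n-i) b_i.                              *)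
Fixpoint fps_inv_seq f n : seq R :=
  if n is n'.+1 then
    let s := fps_inv_seq f n' in
    rcons s ((fpcoef f 0)^-1 *
      ((n' == 0%N)%:R - \sum_(i < n') fpcoef f (n' - i)%N * s`_i))
  else [::].

Definition fps_unit : {pred fps R} := fun f => fpcoef f 0 \is a GRing.unit.
Definition fps_inv f : fps R :=
  if f \in fps_unit then Fps (fun n => (fps_inv_seq f n.+1)`_n) else f.

Let size_inv_seq f n : size (fps_inv_seq f n) = n.
Proof. by elim: n => //= n IHn; rewrite size_rcons IHn. Qed.

Let nth_inv_seq f n i : (i < n)%N ->
  (fps_inv_seq f n)`_i = (fps_inv_seq f i.+1)`_i.
Proof.
elim: n => // n IHn; rewrite ltnS leq_eqVlt => /predU1P[->//|lt_in].
by rewrite [fps_inv_seq f n.+1]/= nth_rcons size_inv_seq lt_in IHn.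
Qed.

Fact fps_mulVx : {in fps_unit, left_inverse 1 fps_inv *%R}.
Proof.
move=> f uf; rewrite /fps_inv uf mulrC; apply/fpsP => n.
rewrite mulrC fpcoefM big_ord_recr /= subnn.
rewrite nth_rcons size_inv_seq ltnn eqxx mulrC mulrA divrr ?mul1r //.
rewrite addrC -addrA [X in _ + X](_ : _ = 0) ?addr0 //.
apply/eqP; rewrite addrC subr_eq0; apply/eqP; apply: eq_bigr => i _.
by rewrite -[rcons _ _]/(fps_inv_seq f i.+1) -(nth_inv_seq f (ltn_ord i)) mulrC.
Qed.
Fact fps_unitPl f g : g * f = 1 -> fps_unit f.
Proof.
move/fpsP/(_ 0%N); rewrite fpcoefM big_ord1 /= => gf1.
by apply/unitrPr; exists (fpcoef g 0); rewrite mulrC.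
Qed.
Fact fps_inv_out : {in [predC fps_unit], fps_inv =1 id}.
Proof. by move=> f; rewrite inE /= /fps_inv => /negPf ->. Qed.

HB.instance Definition _ := GRing.ComNzRing_hasMulInverse.Build (fps R)
  fps_mulVx fps_unitPl fps_inv_out.
End FpsUnitRing.

Definition qpoch (R : pzRingType) (a b : R) (n : nat) : R :=
  \prod_(t < n) (1 - a * b ^+ t).

Definition qbinom (R : comUnitRingType) (q : R) (a b : nat) : R :=
  qpoch q q a / (qpoch q q b * qpoch q q (a - b)).

Local Open Scope nat_scope.

Definition is_intpart (n : nat) (s : seq nat) : bool :=
  [&& sorted geq s, 0 \notin s & sumn s == n].

Record intpart (n : nat) := IntPart {
  parts :> seq nat;
  _ : is_intpart n parts
}.

HB.instance Definition _ n := [isSub for @parts n].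
HB.instance Definition _ n := [Countable of intpart n by <:].

Section IntpartFinite.
Variable n : nat.

Let intpart_size (p : intpart n) : size p <= n.
Proof.
case: p => s /= /and3P[_ s0 /eqP <-].
elim: s s0 => //= x s IHs; rewrite inE negb_or eq_sym => /andP[x0 /IHs le_s].
by rewrite -add1n leq_add // lt0n.
Qed.

Let intpart_bound (p : intpart n) x : x \in (p : seq nat) -> x <= n.
Proof.
case: p => s /= /and3P[_ _ /eqP <-]; elim: s => //= y s IHs.
rewrite inE => /predU1P[->|/IHs le_xs]; first exact: leq_addr.
exact: leq_trans le_xs (leq_addl _ _).
Qed.

Let to_bseq (p : intpart n) : {bseq n of 'I_n.+1} :=
  insub_bseq n [seq inord x | x <- parts p].
Let of_bseq (b : {bseq n of 'I_n.+1}) : option (intpart n) :=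
  insub [seq val x | x <- b].

Let to_bseqK : pcancel to_bseq of_bseq.
Proof.
move=> p; rewrite /of_bseq /to_bseq /insub_bseq insubdK; last first.
  by rewrite -topredE /= size_map intpart_size.
rewrite -map_comp (_ : map _ _ = val p) ?valK //.
rewrite -[RHS]map_id; apply/eq_in_map => x /intpart_bound le_xn /=.
by rewrite inordK.
Qed.

HB.instance Definition _ : isFinite (intpart n) := PCanIsFinite to_bseqK.
End IntpartFinite.

(* Rows and columns are numbered from 1. *)
Definition part (s : seq nat) (i : nat) : nat := nth 0 s i.-1.
Definition conj_part (s : seq nat) (j : nat) : nat := count (leq j) s.

Definition hook_length (s : seq nat) (i j : nat) : int :=
  ((part s i)%:Z + (conj_part s j)%:Z - i%:Z - j%:Z + 1)%R.

Definition fixed_hook_row (h : int) (m : nat) (s : seq nat) (i : nat) : bool :=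
  [&& 1 <= i <= size s, m <= part s i & hook_length s i m == (i%:Z + h)%R].

Definition has_fixed_hook_of_size (h : int) (m k : nat) (s : seq nat) : bool :=
  [exists i : 'I_(size s).+1,
    fixed_hook_row h m s i && (hook_length s i m == k%:Z)].

Definition odd_parts_fixed_hook_gf (h : int) (m k : nat) : fps int :=
  Fps (fun n =>
    #|[set p : intpart n | all odd p & has_fixed_hook_of_size h m k p]|%:Z).

(* Main.v *)
Require Import Defs.
From mathcomp Require Import all_boot all_order all_algebra.
From mathcomp Require Import zify ring.
Import Order.TTheory GRing.Theory Num.Theory.
Local Open Scope ring_scope.

(* Let s = k - h and l = lambda_s - m + 1 (one more than the arm), so that k - l
   parts below row s are at least m. Reading the parts in decreasing order,
   lambda consists of s - 1 odd parts >= m + l - 1, then the part m + l - 1,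
   then k - l odd parts in [m, m + l - 1], then odd parts < m. Peeling off the
   largest part yields a recursion for each block: the third one is a
   q-binomial by the q-Pascal rule, and the first one is its limit as the upper
   bound goes to infinity. *)

(** * Coefficients and units of power series *)

Lemma fpcoefD (R : zmodType) (f g : fps R) n :
  fpcoef (f + g) n = fpcoef f n + fpcoef g n.
Proof. by []. Qed.

Lemma fpcoefB (R : zmodType) (f g : fps R) n :
  fpcoef (f - g) n = fpcoef f n - fpcoef g n.
Proof. by []. Qed.

Lemma fpcoef_sum (R : zmodType) (I : Type) (r : seq I) (D : pred I)
    (F : I -> fps R) n :
  fpcoef (\sum_(i <- r | D i) F i) n = \sum_(i <- r | D i) fpcoef (F i) n.
Proof. by apply: (big_morph (fun f : fps R => fpcoef f n)). Qed.

Lemma fpcoefXM (R : comNzRingType) (f : fps R) n :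
  fpcoef (fpsX R * f) n = if n is n'.+1 then fpcoef f n' else 0.
Proof.
rewrite fpcoefM; case: n => [|n]; first by rewrite big_ord1 mul0r.
rewrite 2!big_ord_recl /= !mul0r add0r mul1r subSS subn0 big1 ?addr0 // => i _.
by rewrite mul0r.
Qed.

Lemma fpcoefXnM (R : comNzRingType) (f : fps R) x n :
  fpcoef (fpsX R ^+ x * f) n = if (n < x)%N then 0 else fpcoef f (n - x).
Proof.
elim: x n => [|x IHx] n; first by rewrite mul1r subn0.
by rewrite exprS -mulrA fpcoefXM; case: n => // n; rewrite IHx.
Qed.

Lemma fps_unitE (R : comUnitRingType) (f : fps R) :
  (f \is a GRing.unit) = (fpcoef f 0 \is a GRing.unit).
Proof. by []. Qed.

Lemma fps_unit_1subMX (R : comUnitRingType) (f : fps R) n :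
  1 - fpsX R ^+ n.+1 * f \is a GRing.unit.
Proof. by rewrite fps_unitE fpcoefB fpcoefXnM subr0 unitr1. Qed.

(** * q-Pochhammer symbols and q-binomials *)

Lemma qpochS (R : pzRingType) (a b : R) n :
  qpoch a b n.+1 = qpoch a b n * (1 - a * b ^+ n).
Proof. by rewrite /qpoch big_ord_recr. Qed.

Lemma qpoch0 (R : pzRingType) (a b : R) : qpoch a b 0 = 1.
Proof. by rewrite /qpoch big_ord0. Qed.

Lemma qpoch_fpsX_unit (R : comUnitRingType) (f g : fps R) n :
  qpoch (fpsX R * f) g n \is a GRing.unit.
Proof.
elim: n => [|n IHn]; first by rewrite qpoch0 unitr1.
by rewrite qpochS unitrM IHn -mulrA -{1}[fpsX R]expr1 fps_unit_1subMX.
Qed.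

(** Multiplying by the units [u r.+1] and [u c.+1] reduces the rule to [u (r + c.+1)] times the
    identity [1 - q^(r+c+2) = q^(c+1) (1 - q^(r+1)) + (1 - q^(c+1))]. *)
Lemma qbinom_pascal (R : comUnitRingType) (q : R) r c :
    (forall n, qpoch q q n \is a GRing.unit) ->
  qbinom q (r.+1 + c.+1) r.+1 =
  q ^+ c.+1 * qbinom q (r + c.+1) r + qbinom q (r.+1 + c) r.+1.
Proof.
move=> uq; rewrite /qbinom !addKn addSnnS.
set u := qpoch q q; have ur := uq r.+1; have uc := uq c.+1.
have [ur0 uc0] := (uq r : u r \is a GRing.unit, uq c : u c \is a GRing.unit).
apply: (mulIr ur); apply: (mulIr uc).
rewrite -/u in ur uc *.
have uS n : u n.+1 = u n * (1 - q * q ^+ n) by apply: qpochS.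
have -> : u (r + c.+2)%N = u (r + c.+1)%N * (1 - q * q ^+ (r + c.+1)).
  by rewrite addnS uS.
have E (a x y : R) : x \is a GRing.unit -> y \is a GRing.unit ->
    a / (x * y) * x * y = a.
  by move=> ux uy; rewrite -!mulrA mulrA divrK ?unitrM ?ux.
rewrite E // !mulrDl.
have -> : q ^+ c.+1 * (u (r + c.+1)%N / (u r * u c.+1)) * u r.+1 * u c.+1 =
    q ^+ c.+1 * (u (r + c.+1)%N / (u r * u c.+1) * u r * u c.+1)
    * (1 - q * q ^+ r).
  by rewrite (uS r); ring.
rewrite E // addSnnS.
have -> : u (r + c.+1)%N / (u r.+1 * u c) * u r.+1 * u c.+1 =
    (u (r + c.+1)%N / (u r.+1 * u c) * u r.+1 * u c) * (1 - q * q ^+ c).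
  by rewrite (uS c); ring.
by rewrite E // exprD !exprS; ring.
Qed.

Lemma qbinom_nn (R : comUnitRingType) (q : R) n :
  (forall n, qpoch q q n \is a GRing.unit) -> qbinom q n n = 1.
Proof. by move=> uq; rewrite /qbinom subnn qpoch0 mulr1 divrr. Qed.

Lemma qbinom_n0 (R : comUnitRingType) (q : R) n :
  (forall n, qpoch q q n \is a GRing.unit) -> qbinom q n 0 = 1.
Proof. by move=> uq; rewrite /qbinom subn0 qpoch0 mul1r divrr. Qed.

(** * Generating functions of predicates on partitions *)

Definition part_gf (P : pred (seq nat)) : fps int :=
  Fps (fun n => #|[set p : intpart n | P p]|%:Z).

Lemma card_intpart n (P : pred (seq nat)) (u : seq (seq nat)) :
    uniq u -> (forall s, (s \in u) = is_intpart n s && P s) ->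
  #|[set p : intpart n | P p]| = size u.
Proof.
move=> uniq_u mem_u; rewrite cardE -(size_map val).
apply/perm_size/uniq_perm => //.
  by rewrite (map_inj_uniq val_inj) enum_uniq.
move=> s; rewrite mem_u; apply/mapP/andP => [[p]|[ps Ps]].
  by rewrite mem_enum inE => Pp ->; split=> //; case: p {Pp}.
by exists (IntPart ps); rewrite ?mem_enum ?inE.
Qed.

Lemma part_gfE P n : fpcoef (part_gf P) n = \sum_(p : intpart n) (P p)%:R.
Proof.
rewrite /= -sum1_card -natz natr_sum big_mkcond /=.
by apply: eq_bigr => p _; rewrite inE; case: (P p).
Qed.

Lemma part_gf_sum (I : Type) (r : seq I) (D : pred I) (F : I -> pred (seq nat))
    (P : pred (seq nat)) :
    (forall s, sorted geq s -> 0%N \notin s ->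
      (P s)%:R = \sum_(i <- r | D i) (F i s)%:R :> int) ->
  part_gf P = \sum_(i <- r | D i) part_gf (F i).
Proof.
move=> eqP; apply/fpsP => n; rewrite part_gfE fpcoef_sum.
under [RHS]eq_bigr do rewrite part_gfE.
rewrite exchange_big; apply: eq_bigr => p _ /=.
by case: p => s /= /and3P[ss s0 _]; rewrite eqP.
Qed.

Lemma eq_part_gf P Q :
    (forall s, sorted geq s -> 0%N \notin s -> P s = Q s) ->
  part_gf P = part_gf Q.
Proof.
move=> eqPQ; apply/fpsP => n; rewrite !part_gfE; apply: eq_bigr => p _.
by case: p => s /= /and3P[ss s0 _]; rewrite eqPQ.
Qed.

Lemma part_gf_split P A B :
    (forall s, sorted geq s -> 0%N \notin s -> P s = A s (+) B s) ->
    (forall s, sorted geq s -> ~~ (A s && B s)) ->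
  part_gf P = part_gf A + part_gf B.
Proof.
move=> eqP dAB; apply/fpsP => n; rewrite fpcoefD !part_gfE -big_split.
apply: eq_bigr => p _; case: p => s /= /and3P[ss s0 _].
by rewrite eqP //; move: (dAB s ss); case: (A s); case: (B s).
Qed.

(** Deleting the first part is a bijection onto partitions of [n - x]; [path geq x t] is what the
    ordering of [x :: t] demands of [t]. *)
Lemma part_gf_cons x P : (0 < x)%N ->
  part_gf (fun s => if s is y :: t then (y == x) && P t else false) =
  fpsX int ^+ x * part_gf (fun t => path geq x t && P t).
Proof.
move=> x_gt0; apply/fpsP => n; rewrite fpcoefXnM /=.
pose e := enum [set p : intpart (n - x) | path geq x p && P p].
(* For [n < x] the difference [n - x] is truncated to [0], where the empty partition could be
   counted by mistake. *)
pose u := if (n < x)%N then [::] else [seq x :: parts p | p <- e].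
pose P' s := if s is y :: t then (y == x) && P t else false.
rewrite -[LHS]/(#|[set p : intpart n | P' p]|%:Z) (@card_intpart _ P' u) /u.
- by case: ifP; rewrite ?size_map ?cardE.
- case: ifP => // _; rewrite map_inj_uniq ?enum_uniq // => p1 p2 [eqp].
  exact: val_inj.
move=> s; case: ltnP => [lt_nx|le_xn].
  rewrite in_nil; apply/esym/negP => /andP[/and3P[_ _ /eqP sn]].
  by case: s sn => // y t /= sn /andP[/eqP yx _]; lia.
apply/mapP/idP => [[p]|].
  rewrite /e mem_enum inE => /andP[px Pp] ->.
  rewrite /is_intpart /= eqxx Pp px andbT.
  case: p {px Pp} => t /= /and3P[_ t0 /eqP ->].
  by rewrite inE negb_or t0 subnKC // eqxx !andbT eq_sym -lt0n.
case: s => [|y t]; rewrite ?andbF // => /andP[/and3P[/= px t0 /eqP sn]].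
move=> /andP[/eqP yx Pt]; move: t0; rewrite inE negb_or => /andP[_ t0].
have pt : is_intpart (n - x) t.
  by rewrite /is_intpart (path_sorted px) t0 /= -sn yx addKn.
by exists (IntPart pt); rewrite ?yx // /e mem_enum inE /= Pt -yx px.
Qed.

(** * Blocks of odd parts between two bounds *)

Definition block (a b r : nat) (Q : pred (seq nat)) (s : seq nat) :=
  [&& (r <= size s)%N, all (fun y => odd y && (a <= y <= b)%N) (take r s)
    & Q (drop r s)].

Lemma block_cons a b r (Q : pred (seq nat)) y t :
  block a b r.+1 Q (y :: t) = odd y && (a <= y <= b)%N && block a b r Q t.
Proof. by rewrite /block /= ltnS -andbA andbCA -!andbA. Qed.

Lemma block_le a b r (Q : pred (seq nat)) s : (a <= b)%N ->
    (forall u, Q u -> all (geq b) u) ->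
  block a b r Q s -> all (geq b) s.
Proof.
move=> le_ab Qb /and3P[_ alls Qs].
rewrite -(cat_take_drop r s) all_cat (Qb _ Qs) andbT.
by apply: sub_all alls => y /and3P[].
Qed.

Lemma path_geqE x t : path geq x t = all (geq x) t && sorted geq t.
Proof. by apply: path_sortedE => y z w /= zy yw; apply: leq_trans yw zy. Qed.

(** The case of the recursion where the largest part attains the bound. What follows is at most [b],
    so the path condition left by [part_gf_cons] is automatic. *)
Lemma part_gf_blockS a b r (Q : pred (seq nat)) :
    (0 < b)%N -> odd b -> (a <= b)%N ->
    (forall u, Q u -> all (geq b) u) ->
  part_gf (fun s => block a b r.+1 Q s && (head 0%N s == b)) =
  fpsX int ^+ b * part_gf (block a b r Q).
Proof.
move=> b0 oddb le_ab Qb.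
rewrite -(_ : part_gf (fun t => path geq b t && block a b r Q t) =
   part_gf (block a b r Q)).
  rewrite -part_gf_cons //; apply: eq_part_gf => -[|y t] _ _.
    by rewrite /block.
  rewrite block_cons andbC /=; case: eqP => //= ->.
  by rewrite oddb le_ab leqnn.
apply: eq_part_gf => t st _; rewrite path_geqE st andbT andb_idl //.
exact: block_le.
Qed.

(** The other case: an odd first part below the odd bound is smaller by at least two, and the
    ordering passes the new bound on to the rest of the block. *)
Lemma sorted_block_head a c r (Q : pred (seq nat)) s : sorted geq s -> odd a ->
  block a (a + c.+1.*2) r.+1 Q s && (head 0%N s != a + c.+1.*2)%N =
  block a (a + c.*2) r.+1 Q s.
Proof.
case: s => [|y t]; first by rewrite /block.
rewrite [sorted _ _]path_geqE => /andP[/allP ty _] odda.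
rewrite !block_cons /=.
have [oddy|] := boolP (odd y) => //=.
have -> : (a <= y <= a + c.*2)%N =
    (a <= y <= a + c.+1.*2)%N && (y != a + c.+1.*2)%N by lia.
have [ay|]//= := boolP (a <= y <= _)%N.
have [//|ney] := eqVneq y (a + c.+1.*2)%N; rewrite ?andbF // andbT /block.
congr [&& _, _ & _]; apply: eq_in_all => z /mem_take /ty /= zy.
have [oddz|]//= := boolP (odd z).
lia.
Qed.

Local Notation X := (fpsX int).

Lemma qpoch_sq_unit n : qpoch (X ^+ 2) (X ^+ 2) n \is a GRing.unit.
Proof. by rewrite {1}expr2 qpoch_fpsX_unit. Qed.

(** Induction on [r], then on [c]: whether or not the largest part attains the bound gives the two
    terms of the q-Pascal rule. The base is [X ^+ 2] because the parts of the block, reduced by [a]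
    and halved, form a partition in an [r] by [c] box. *)
Lemma part_gf_block a c r (Q : pred (seq nat)) :
    odd a -> (forall u, Q u -> all (geq a) u) ->
  part_gf (block a (a + c.*2) r Q) =
  X ^+ (r * a) * qbinom (X ^+ 2) (r + c) r * part_gf Q.
Proof.
move=> odda Qa.
have leQ b u : (a <= b)%N -> Q u -> all (geq b) u.
  by move=> le_ab /Qa; apply: sub_all => y /= ya; apply: leq_trans le_ab.
elim: r c => [|r IHr] c.
  rewrite (qbinom_n0 _ _ _ qpoch_sq_unit) mul1r mul1r.
  apply: eq_part_gf => s _ _.
  by rewrite /block take0 drop0.
elim: c => [|c IHc].
  (* With [c = 0] all parts of the block equal [a], so the largest one always attains the bound. *)
  have a0 := odd_gt0 odda.
  have := IHr 0%N; rewrite !addn0 !(qbinom_nn _ _ _ qpoch_sq_unit) !mulr1.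
  move=> {}IHr.
  rewrite mulSn exprD -mulrA -IHr -part_gf_blockS //.
  apply: eq_part_gf => -[|y t] _ _; rewrite ?block_cons ?andbF //=.
  by case: (y == a) / eqP => [_|ya]; rewrite ?andbT // andbF; apply/negP; lia.
rewrite (@part_gf_split _
   (fun s => block a (a + c.+1.*2) r.+1 Q s && (head 0%N s == a + c.+1.*2)%N)
   (block a (a + c.*2) r.+1 Q)); last 2 first.
- move=> s ss _; rewrite -(sorted_block_head _ c _ _ _ ss) //.
  by case: (block _ _ _ _ _); case: (_ == _).
- move=> s ss; rewrite -(sorted_block_head _ c _ _ _ ss) //.
  by case: (block _ _ _ _ _); case: (_ == _).
rewrite part_gf_blockS; [|lia..|by move=> u; apply: leQ; lia].
rewrite IHr IHc (qbinom_pascal _ _ _ _ qpoch_sq_unit).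
rewrite -exprM mulSn !exprD -muln2 mulnC.
ring.
Qed.

(** * Blocks without an upper bound *)

(** The extra factors are [1 - X ^+ (2 * t + 2)] with [t >= n], hence [1] modulo [X ^+ n.+1]; the
    cofactor [w] expresses this congruence. *)
Lemma qpochD_fpsX r n : exists w : fps int,
  qpoch (X ^+ 2) (X ^+ 2) (r + n) =
  qpoch (X ^+ 2) (X ^+ 2) n * (1 + X ^+ n.+1 * w).
Proof.
elim: r => [|r [w IHr]]; first by exists 0; rewrite mulr0 addr0 mulr1.
pose v : fps int := X ^+ (n + r.*2).+1.
(* Read off from the product [(1 + X ^+ n.+1 * w) * (1 - X ^+ n.+1 * v)], whose second factor is the
   new one. *)
exists (w - v - X ^+ n.+1 * w * v).
rewrite addSn qpochS IHr.
rewrite (_ : X ^+ 2 * (X ^+ 2) ^+ (r + n) = X ^+ n.+1 * v); first by ring.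
by rewrite /v -exprM -!exprD; congr (_ ^+ _); lia.
Qed.

Definition upper_block (a r : nat) (Q : pred (seq nat)) (s : seq nat) :=
  [&& (r <= size s)%N, all (fun y => odd y && (a <= y)%N) (take r s)
    & Q (drop r s)].

Lemma mem_leq_sumn (s : seq nat) x : x \in s -> (x <= sumn s)%N.
Proof. by move=> xs; rewrite (perm_sumn (perm_to_rem xs)) leq_addr. Qed.

Lemma part_gf_upper_block a r (Q : pred (seq nat)) : odd a ->
    (forall u, Q u -> all (geq a) u) ->
  part_gf (upper_block a r Q) =
  X ^+ (r * a) / qpoch (X ^+ 2) (X ^+ 2) r * part_gf Q.
Proof.
move=> odda Qa; apply/fpsP => n.
(* The limit is taken one coefficient at a time: no part of a partition of [n] exceeds [n], so the
   bound [a + n.*2] excludes nothing. *)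
have -> : fpcoef (part_gf (upper_block a r Q)) n =
    fpcoef (part_gf (block a (a + n.*2) r Q)) n.
  rewrite !part_gfE; apply: eq_bigr => p _; congr (_%:R); congr nat_of_bool.
  rewrite /upper_block /block; congr [&& _, _ & _].
  apply: eq_in_all => y /mem_take /mem_leq_sumn.
  case: p => s /= /and3P[_ _ /eqP ->] yn.
  by have [oddy|]//= := boolP (odd y); lia.
rewrite part_gf_block //.
have [w rnE] := qpochD_fpsX r n.
(* The symbol of length [n] cancels; the remaining error is divisible by [X ^+ n.+1] and invisible
   in degree [n]. *)
have -> : qbinom (X ^+ 2) (r + n) r =
    (1 + X ^+ n.+1 * w) / qpoch (X ^+ 2) (X ^+ 2) r.
  rewrite /qbinom rnE addKn invrM ?qpoch_sq_unit // mulrA; congr (_ / _).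
  by rewrite mulrC mulKr ?qpoch_sq_unit.
set f := _ / _ * _.
rewrite (_ : _ * _ = f + X ^+ n.+1 * (w * f)); last by rewrite /f; ring.
by rewrite fpcoefD fpcoefXnM ltnSn addr0.
Qed.

(** * Odd parts below an even bound *)

Definition odd_parts_lt (b : nat) : pred (seq nat) :=
  all (fun y => odd y && (y < b)%N).

(** Peeling off a largest part [c.*2.+1], which may recur, gives
    [G_(c+1) = G_c + X ^+ c.*2.+1 * G_(c+1)]; this is solved for [G_(c+1)] since [1 - X ^+ c.*2.+1]
    is a unit. *)
Lemma part_gf_odd_parts_lt c :
  part_gf (odd_parts_lt c.*2) = (qpoch X (X ^+ 2) c)^-1.
Proof.
elim: c => [|c IHc].
  rewrite qpoch0 invr1; apply/fpsP => n /=.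
  pose u := if n is 0%N then [:: [::]] else [::] : seq (seq nat).
  rewrite (@card_intpart _ _ u); rewrite /u; try by case: (n).
  move=> [|y t]; last by rewrite /= ltn0 andbF andbF; case: (n).
  by case: n {u}.
have uq i : qpoch X (X ^+ 2) i \is a GRing.unit.
  by rewrite -{1}[X]mulr1 qpoch_fpsX_unit.
have u1 : 1 - X * (X ^+ 2) ^+ c \is a GRing.unit.
  by rewrite -{1}[X]expr1 fps_unit_1subMX.
rewrite qpochS invrM // -IHc; apply: (mulrI u1); rewrite mulVKr //.
apply/eqP; rewrite mulrBl mul1r subr_eq addrC -exprM -exprS mul2n; apply/eqP.
have -> : X ^+ c.*2.+1 * part_gf (odd_parts_lt c.+1.*2) =
    X ^+ c.*2.+1
    * part_gf (fun t => path geq c.*2.+1 t && odd_parts_lt c.+1.*2 t).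
  congr (_ * _); apply: eq_part_gf => t st _.
  rewrite path_geqE st andbT andb_idl //.
  by apply: sub_all => y /andP[oddy] /=; rewrite doubleS ltnS.
rewrite -part_gf_cons //.
apply: part_gf_split => [[|y t] st _|[|y t] st] //; rewrite /odd_parts_lt /=.
  have [->|ny] /= := eqVneq y c.*2.+1.
    by rewrite odd_double doubleS leqnn [(_ < c.*2)%N]ltnNge leqnSn /= addbF.
  have -> : odd y && (y < c.+1.*2)%N = odd y && (y < c.*2)%N by lia.
  case: ltnP => ylt; rewrite ?andbF // !andbT; congr (_ && _).
  apply: eq_in_all => z zt.
  move: st; rewrite [sorted _ _]path_geqE => /andP[/allP /(_ z zt) /= zy _].
  by congr (_ && _); lia.
have [->|//] /= := eqVneq y c.*2.+1.
by rewrite [(_ < c.*2)%N]ltnNge leqnSn !andbF.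
Qed.

(** * The shape of a partition around its hook *)

(** In a decreasing sequence the parts at least [m] form a prefix. This turns a value of the
    conjugate part into conditions on blocks. *)
Lemma sorted_count_leq m i s : sorted geq s ->
  (count (leq m) s == i) =
  [&& (i <= size s)%N, all (leq m) (take i s) & all (gtn m) (drop i s)].
Proof.
elim: s i => [|y t IHt] i; first by case: i.
rewrite [sorted _ _]path_geqE => /andP[/allP ty st].
case: i => [|i] /=.
  have [le_my|lt_ym] //= := leqP m y.
  rewrite add0n -leqn0 leqNgt -has_count -all_predC.
  by apply: eq_all => z /=; rewrite ltnNge.
have [le_my|lt_ym] /= := leqP m y; first by rewrite add1n eqSS IHt.
rewrite add0n andbF; apply/negbTE/eqP => ct.
have /hasP[z /ty /= zy mz] : has (leq m) t by rewrite has_count ct.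
lia.
Qed.

(* r = k - h - 1, j = k - l, and 2c + 1 is the least odd number >= m. *)
Definition hook_shape (x r j c : nat) : pred (seq nat) :=
  upper_block x r (fun u =>
    if u is y :: t then
      (y == x) && block c.*2.+1 x j (odd_parts_lt c.*2) t
    else false).

Lemma part_gf_hook_shape c d r j : let x := (c.*2.+1 + d.*2)%N in
  part_gf (hook_shape x r j c) =
  X ^+ (r * x + x + j * c.*2.+1)
  / (qpoch (X ^+ 2) (X ^+ 2) r * qpoch X (X ^+ 2) c)
  * qbinom (X ^+ 2) (j + d) j.
Proof.
move=> x; have ltx u : odd_parts_lt c.*2 u -> all (geq c.*2.+1) u.
  by apply: sub_all => y /andP[_] /=; lia.
have blx t : block c.*2.+1 x j (odd_parts_lt c.*2) t -> all (geq x) t.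
  apply: block_le => [|u /ltx]; first exact: leq_addr.
  by apply: sub_all => y /= /leq_trans; apply; apply: leq_addr.
have uq : qpoch X (X ^+ 2) c \is a GRing.unit.
  by rewrite -{1}[X]mulr1 qpoch_fpsX_unit.
rewrite /hook_shape part_gf_upper_block; last 2 first.
- by rewrite /x oddD /= !odd_double.
- by case=> // y t /andP[/eqP -> /blx] /= ->; rewrite leqnn.
rewrite part_gf_cons //.
rewrite (_ : part_gf _ = part_gf (block c.*2.+1 x j (odd_parts_lt c.*2))).
  rewrite part_gf_block //= ?odd_double // part_gf_odd_parts_lt.
  by rewrite invrM ?qpoch_sq_unit // !exprD; ring.
apply: eq_part_gf => t st _; rewrite path_geqE st andbT andb_idl //.
exact: blx.
Qed.

(** The ordering supplies the bounds: parts before index [r] are at least [x], later ones at most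
    [x]. The first [r.+1] parts are thus at least [m], and the count asks for exactly [j] more. As
    [m] and [c.*2.+1] cut the odd numbers at the same place, both parities of [m] are covered. *)
Lemma hook_shapeE m c x r j s : sorted geq s ->
    (forall y, odd y -> (m <= y)%N = (c.*2 < y)%N) -> odd x -> (m <= x)%N ->
  hook_shape x r j c s =
  [&& all odd s, (r < size s)%N, nth 0%N s r == x
    & count (leq m) s == (r.+1 + j)%N].
Proof.
move=> ss mc oddx mx; rewrite /hook_shape /upper_block.
have [lt_rs|le_sr] := ltnP r (size s); last by rewrite drop_oversize // !andbF.
rewrite (drop_nth 0%N lt_rs) ltnW //=.
have sz : size (take r s) = r by rewrite size_takel // ltnW.
have := cat_take_drop r s; rewrite (drop_nth 0%N lt_rs).
move: (take r s) (nth 0%N s r) (drop r.+1 s) sz => A y t sz sE.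
rewrite -{}sE {s lt_rs} in ss *.
move: ss; have [{y}-> |] := eqVneq y x; last by rewrite !andbF.
rewrite (sorted_pairwise (rev_trans leq_trans)) pairwise_cat /=.
have x_xt : x \in x :: t by rewrite mem_head.
case/and3P => /allrelP Ax _ /andP[/allP tx st].
rewrite -(sorted_pairwise (rev_trans leq_trans)) in st.
rewrite all_cat count_cat /= mx oddx /=.
have /eqP -> : count (leq m) A == r.
  rewrite -sz -all_count; apply/allP => z /Ax /(_ x_xt) /=.
  exact: leq_trans.
rewrite addnA addn1 eqn_add2l sorted_count_leq //.
have -> : all (fun z => odd z && (x <= z)%N) A = all odd A.
  apply: eq_in_all => z zA; rewrite andbC andb_idl // => _.
  exact: Ax zA x_xt.
rewrite -andbA; congr andb.
have -> : all odd t = all odd (take j t) && all odd (drop j t).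
  by rewrite -all_cat cat_take_drop.
rewrite /block -!andbA; case: (j <= size t)%N; rewrite ?andbF //=.
rewrite /odd_parts_lt.
have -> : all (fun z => odd z && (c.*2 < z <= x)%N) (take j t) =
   all odd (take j t) && all (leq m) (take j t).
  rewrite -all_predI; apply: eq_in_all => z /mem_take /tx /= zx.
  by have [/mc ->|] //= := boolP (odd z); rewrite zx andbT.
have -> : all (fun z => odd z && (z < c.*2)%N) (drop j t) =
   all odd (drop j t) && all (gtn m) (drop j t).
  rewrite -all_predI; apply: eq_all => z /=.
  have [/[dup]/mc|] //= := boolP (odd z) => mz oz.
  rewrite [RHS]ltnNge mz -leqNgt [RHS]leq_eqVlt; case: eqP => // zc.
  by rewrite zc odd_double in oz.
by rewrite -!andbA; congr andb; rewrite andbCA.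
Qed.

(** * Fixed hooks as a disjoint union of shapes *)

(** Equating [i + h] with [k] forces row [r.+1], which has index [r] in the sequence. *)
Lemma has_fixed_hook_of_sizeE (m k r : nat) s :
  has_fixed_hook_of_size (k%:Z - r%:Z - 1) m k s =
  [&& (r < size s)%N, (m <= nth 0 s r)%N
    & nth 0 s r + count (leq m) s == k + r + m]%N.
Proof.
apply/existsP/idP => [[i]|/and3P[rs mr hk]].
  case/andP => /and3P[/andP[i0 iS] mi hi] hk.
  have ri : i = r.+1 :> nat by move/eqP: hi; rewrite (eqP hk); lia.
  move: iS mi hk; rewrite /hook_length /part /conj_part ri /= => -> -> /=; lia.
have ri : (r.+1 < (size s).+1)%N by [].
exists (Ordinal ri).
rewrite /fixed_hook_row /hook_length /part /conj_part /= rs mr /=.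
lia.
Qed.

(** The part in row [r.+1] determines [l], so at most one summand is nonzero. *)
Lemma fixed_hook_indicator (m k r c : nat) s : (0 < m)%N ->
    (forall y, odd y -> (m <= y)%N = (c.*2 < y)%N) -> sorted geq s ->
  (all odd s && has_fixed_hook_of_size (k%:Z - r%:Z - 1) m k s)%:R =
  \sum_(1 <= l < k.+1 | odd (m + l - 1))
    (hook_shape (m + l - 1) r (k - l) c s)%:R :> int.
Proof.
move=> m0 mc ss; rewrite has_fixed_hook_of_sizeE.
have shapeE l : (0 < l)%N -> odd (m + l - 1) ->
    hook_shape (m + l - 1) r (k - l) c s =
    [&& all odd s, (r < size s)%N, nth 0%N s r == (m + l - 1)%N
      & count (leq m) s == (r.+1 + (k - l))%N].
  by move=> l0 odl; apply: hook_shapeE => //; lia.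
have [/and4P[os rs mr /eqP hk]|nhook] := boolP [&& _, _, _ & _].
  pose l0 := (nth 0 s r - m).+1%N.
  have l00 : (0 < l0)%N by [].
  have ml0 : (m + l0 - 1)%N = nth 0%N s r by rewrite /l0; lia.
  have odl0 : odd (m + l0 - 1) by rewrite ml0 (allP os) ?mem_nth.
  (* Row [r.+1] reaches column [m], so that column has length at least [r.+1]; the hook equation
     then gives [l0 <= k]. *)
  have cnt : (r < count (leq m) s)%N.
    have := sorted_count_leq m (count (leq m) s) s ss.
    rewrite eqxx => /esym /and3P[_ _ /allP lt_m].
    rewrite ltnNge; apply/negP => le_r.
    have /lt_m /= : nth 0%N s r \in drop (count (leq m) s) s.
      rewrite -{1}(subnKC le_r) -nth_drop mem_nth // size_drop.
      by rewrite ltn_sub2r // (leq_ltn_trans le_r).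
    by rewrite ltnNge mr.
  have l0in : l0 \in index_iota 1 k.+1 by rewrite mem_index_iota; lia.
  rewrite big_mkcond (bigD1_seq l0) ?iota_uniq //= odl0 shapeE //.
  rewrite big1_seq ?addr0.
    rewrite os rs ml0 eqxx /= (_ : count _ s = (r.+1 + (k - l0))%N) ?eqxx //.
    by rewrite /l0; lia.
  move=> l; rewrite mem_index_iota => /andP[nl /andP[l1 _]].
  case: ifP => // odl; rewrite shapeE //.
  suff -> : (nth 0%N s r == (m + l - 1)%N) = false by rewrite andFb !andbF.
  by apply/negbTE; move: nl; rewrite /l0; lia.
rewrite big1_seq // => l; rewrite mem_index_iota => /andP[odl /andP[l1 lk]].
rewrite shapeE // -[RHS]/(false%:R); congr _%:R; congr nat_of_bool.
apply: contraNF nhook => /and4P[-> -> /eqP -> /eqP ->] /=.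
by apply/andP; split; lia.
Qed.

Lemma odd_parts_fixed_hook_gfE (m k r c : nat) : (0 < m)%N ->
    (forall y, odd y -> (m <= y)%N = (c.*2 < y)%N) ->
  odd_parts_fixed_hook_gf (k%:Z - r%:Z - 1) m k =
  \sum_(1 <= l < k.+1 | odd (m + l - 1))
    part_gf (hook_shape (m + l - 1) r (k - l) c).
Proof.
move=> m0 mc.
apply: (@part_gf_sum _ _ _ _
  (fun s => all odd s && has_fixed_hook_of_size (k%:Z - r%:Z - 1) m k s)).
by move=> s ss _; apply: fixed_hook_indicator.
Qed.

Theorem theorem3p3 (m k : nat) (h : int)
    (hm : (1 <= m)%N) (hk : (1 <= k)%N) (hh : h <= k%:Z - 1) :
  let q : fps int := fpsX int in
  (odd m ->
     odd_parts_fixed_hook_gf h m k =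
     \sum_(1 <= l < k.+1 | odd l)
        q ^ (k%:Z + l%:Z * (k%:Z - h - 1)
             + (m%:Z - 1) * (2 * k%:Z - h - l%:Z))
        / (qpoch (q ^+ 2) (q ^+ 2) (absz (k%:Z - h - 1)%R)
           * qpoch q (q ^+ 2) ((m - 1)./2))
        * qbinom (q ^+ 2) (k - l + (l - 1)./2) (k - l))
  /\
  (~~ odd m ->
     odd_parts_fixed_hook_gf h m k =
     \sum_(1 <= l < k.+1 | ~~ odd l)
        q ^ (k%:Z + l%:Z * (k%:Z - h - 1)
             + (m%:Z - 1) * (2 * k%:Z - h - l%:Z) + (k%:Z - l%:Z))
        / (qpoch (q ^+ 2) (q ^+ 2) (absz (k%:Z - h - 1)%R)
           * qpoch q (q ^+ 2) (m./2))
        * qbinom (q ^+ 2) (k - l + (l - 2)./2) (k - l)).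
Proof.
(* [h <= k - 1] makes [k - h - 1] a natural number [r], the number of rows above the hook. *)
move=> q; have [r rE] : exists r : nat, k%:Z - h - 1 = r%:Z.
  by exists (absz (k%:Z - h - 1)%R); lia.
have -> : h = k%:Z - r%:Z - 1 by lia.
have -> : k%:Z - (k%:Z - r%:Z - 1) - 1 = r%:Z by lia.
split=> [oddm|evenm].
  (* For odd [m] the third block starts at [m], and its upper bound is [m + (l - 1)] with [l - 1]
     even. *)
  rewrite (@odd_parts_fixed_hook_gfE m k r (m - 1)./2) //; last first.
    by move=> y; lia.
  rewrite big_seq_cond [RHS]big_seq_cond; apply: eq_big => [l|l].
    by rewrite mem_index_iota; lia.
  rewrite mem_index_iota => /andP[/andP[l1 lk] odl].
  rewrite (_ : (m + l - 1)%N = ((m - 1)./2.*2.+1 + (l - 1)./2.*2)%N);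
    last by lia.
  rewrite part_gf_hook_shape; congr (_ / _ * _).
  rewrite exprnP; congr (_ ^ _).
  (* Writing [k] as [l + j] removes the truncated [k - l] before the exponents are compared over the
     integers. *)
  have [j ->] : exists j, k = (l + j)%N by exists (k - l)%N; rewrite subnKC.
  have -> : ((m - 1)./2.*2.+1 + (l - 1)./2.*2 = m + l - 1)%N by lia.
  have -> : (m - 1)./2.*2.+1 = m by lia.
  rewrite addKn !(PoszD, PoszM) -subzn; [rewrite PoszD; ring | lia].
(* For even [m] the block starts at [m + 1], so its upper bound is [(m + 1) + (l - 2)]; its [k - l]
   parts, each with minimum one larger, account for the extra [k - l] in the exponent. *)
rewrite (@odd_parts_fixed_hook_gfE m k r m./2) //; last by move=> y; lia.
rewrite big_seq_cond [RHS]big_seq_cond; apply: eq_big => [l|l].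
  by rewrite mem_index_iota; lia.
rewrite mem_index_iota => /andP[/andP[l1 lk] odl].
rewrite (_ : (m + l - 1)%N = (m./2.*2.+1 + (l - 2)./2.*2)%N); last by lia.
rewrite part_gf_hook_shape; congr (_ / _ * _).
rewrite exprnP; congr (_ ^ _).
have [j ->] : exists j, k = (l + j)%N by exists (k - l)%N; rewrite subnKC.
have -> : (m./2.*2.+1 + (l - 2)./2.*2 = m + l - 1)%N by lia.
have -> : m./2.*2 = m by lia.
rewrite addKn !(PoszD, PoszM) -subzn; [rewrite PoszD; ring | lia].
Qed.
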